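(* Let $N\ge1$, $0\le h<k\le N$ with $\gcd(h,k)=1$, $\rho=e^{2\pi i h/k}$, $s:=\lfloor N/k\rfloor$ and $1\le\ell\le s$. Then \[ C_{hk\ell}(N)= \frac{(-1)^{s}\rho^\ell}{ k^{2s} s!}\left( \prod_{d=1}^{N-k s} \frac{1}{1-\rho^d}\right) \sum_{m=0}^{s-\ell}\ \sum_{ \substack{i_1, \dots ,i_m \ge 1,\ i_1+ \cdots +i_m=s-\ell \\ 1\le r_1 \le r_2 \le \cdots \le r_m \le N }} G_\rho(r_1,i_1) G_\rho(r_2,i_2) \cdots G_\rho(r_m,i_m), \] where the $m=0$ term is the empty product $1$ (it occurs only when $s=\ell$), and $G_\rho(r,i)=-\frac1r\binom{r}{i+1}$ if $k\mid r$, $G_\rho(r,i)=\frac{\rho^r}{1-\rho^r}\binom{r}{i}$ if $k\nmid r$.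
   Context: For an integer $N\ge1$, Rademacher's coefficients $C_{hk\ell}(N)\in\mathbb{C}$ are defined by the (unique) partial fraction decomposition $\prod_{j=1}^N \frac{1}{1-q^j}=\sum_{0\le h<k\le N,\ \gcd(h,k)=1}\ \sum_{\ell=1}^{\lfloor N/k\rfloor} \frac{C_{hk\ell}(N)}{(q-e^{2\pi i h/k})^\ell}$. An empty product (e.g. $\prod_{d=1}^{0}$) equals $1$. *)

(* Defs.v *)
From HB Require Import structures.
From mathcomp Require Import all_boot all_order all_algebra.
From mathcomp Require Import reals trigo.
From mathcomp Require Import complex.

Set Implicit Arguments.
Unset Strict Implicit.
Unset Printing Implicit Defensive.

Import Order.TTheory GRing.Theory Num.Theory.
Local Open Scope ring_scope.
Local Open Scope complex_scope.

(* e^{2 pi i h / k}, written out by Euler's formula. *)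
Definition unity_root (R : realType) (h k : nat) : R[i] :=
  let t : R := 2 * pi * h%:R / k%:R in cos t +i* sin t.

(* [C h k l] is C_{hkl}(N): the family [C] gives the partial fraction
   decomposition of prod_{j=1}^N 1/(1 - q^j).  The equality of rational
   functions is tested at all points q that are not poles.  Only the values of
   [C] at indices occurring in the sum are constrained. *)
Definition rademacher_coefficients (R : realType) (N : nat)
    (C : nat -> nat -> nat -> R[i]) : Prop :=
  forall q : R[i],
    (forall j : nat, (1 <= j <= N)%N -> q ^+ j != 1) ->
    \prod_(1 <= j < N.+1) (1 - q ^+ j)^-1 =
    \sum_(1 <= k < N.+1) \sum_(0 <= h < k | coprime h k)
      \sum_(1 <= l < (N %/ k).+1) C h k l / (q - unity_root R h k) ^+ l.

Definition G (R : realType) (k : nat) (rho : R[i]) (r i : nat) : R[i] :=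
  if (k %| r)%N then - (r%:R)^-1 * 'C(r, i.+1)%:R
  else rho ^+ r / (1 - rho ^+ r) * 'C(r, i)%:R.

(* The 0-based index j : 'I_m stands for the subscript j + 1.  Bounding the
   i_j by n loses nothing, as they are positive integers with sum n. *)
Definition composition (n m : nat) (i : {ffun 'I_m -> 'I_n.+1}) : bool :=
  [forall j : 'I_m, (1 <= i j)%N] && (\sum_(j < m) i j == n)%N.

Definition weakly_increasing (N m : nat) (r : {ffun 'I_m -> 'I_N.+1}) : bool :=
  [forall j : 'I_m, (1 <= r j)%N] &&
  [forall a : 'I_m, forall b : 'I_m, (a <= b)%N ==> (r a <= r b)%N].

(* Main.v *)
(* Substitute q = rho (1 + x).  Then 1 - q^r is 1 - rho^r (if k does not divide
   r) or - r x (if it does), times 1 - g_r(x) with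
   g_r(x) = sum_{i >= 1} G_rho(r, i) x^i.  Hence prod_r 1/(1 - q^r) is a constant
   times x^{-s} prod_r 1/(1 - g_r(x)), and the last product is the sum of the
   complete homogeneous symmetric polynomials in g_1, ..., g_N.  Since all other
   poles are regular at x = 0, C_{hkl}(N) is rho^l times the coefficient of
   x^{-l}.  The constant is evaluated with prod_{d=1}^{k-1} (1 - rho^d) = k.
   Power series are replaced by polynomials modulo a power of 'X. *)
Require Import Defs.
From HB Require Import structures.
From mathcomp Require Import all_boot all_order all_algebra.
From mathcomp Require Import reals trigo.
From mathcomp Require Import complex ring lra.

Set Implicit Arguments.
Unset Strict Implicit.
Unset Printing Implicit Defensive.

Import Order.TTheory GRing.Theory Num.Theory.
Local Open Scope ring_scope.
Local Open Scope complex_scope.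

(** * Complete homogeneous symmetric polynomials and their recursion *)

Section Homogeneous.

Variables (R : comNzRingType) (N : nat) (g : nat -> R).

(* [winc 1] is [weakly_increasing]; the lower bound [a] is what the recursion
   on the first entry needs. *)
Definition winc (a m : nat) (r : {ffun 'I_m -> 'I_N.+1}) : bool :=
  [forall j : 'I_m, (a <= r j)%N] &&
  [forall i : 'I_m, forall j : 'I_m, (i <= j)%N ==> (r i <= r j)%N].

(** The complete homogeneous symmetric polynomial of degree [m] in [g a], ..., [g N]. *)
Definition hsym (a m : nat) : R :=
  \sum_(r : {ffun 'I_m -> 'I_N.+1} | winc a r) \prod_(j < m) g (r j).

Definition fcons (T : Type) (m : nat) (p : T * {ffun 'I_m -> T}) :
    {ffun 'I_m.+1 -> T} :=
  [ffun i => oapp p.2 p.1 (unlift ord0 i)].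

Lemma fcons0 T m (p : T * {ffun 'I_m -> T}) : fcons p ord0 = p.1.
Proof. by rewrite ffunE unlift_none. Qed.

Lemma fconsS T m (p : T * {ffun 'I_m -> T}) j :
  fcons p (lift ord0 j) = p.2 j.
Proof. by rewrite ffunE liftK. Qed.

Lemma fcons_bij (T : Type) m : bijective (@fcons T m).
Proof.
exists (fun f : {ffun 'I_m.+1 -> T} =>
  (f ord0, [ffun j => f (lift ord0 j)])).
  case=> b f; rewrite fcons0; congr pair.
  by apply/ffunP=> j; rewrite ffunE fconsS.
move=> f; apply/ffunP=> i; rewrite ffunE.
by case: unliftP => [j|] ->; rewrite /= ?ffunE.
Qed.

Lemma winc_fcons a m (b : 'I_N.+1) (f : {ffun 'I_m -> 'I_N.+1}) :
  winc a (fcons (b, f)) = (a <= b)%N && winc b f.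
Proof.
apply/andP/and3P => [[/forallP ha /forallP hi]|[hab /forallP hb /forallP hi]].
  split.
  - by have := ha ord0; rewrite fcons0.
  - apply/forallP => j; have /forallP/(_ (lift ord0 j)) := hi ord0.
    by rewrite fcons0 fconsS.
  - apply/forallP => i; apply/forallP => j.
    have /forallP/(_ (lift ord0 j)) := hi (lift ord0 i).
    by rewrite !fconsS !lift0 ltnS.
split; apply/forallP => i.
  case: (unliftP ord0 i) => [j|] ->; rewrite ?fcons0 ?fconsS //=.
  exact: leq_trans hab (hb j).
apply/forallP => j.
case: (unliftP ord0 i) => [i'|] ->; case: (unliftP ord0 j) => [j'|] ->;
  rewrite ?fcons0 ?fconsS ?leqnn ?implybT ?hb ?implybT //.
rewrite !lift0 ltnS.
by have /forallP := hi i'; apply.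
Qed.

Lemma hsym0 a : hsym a 0 = 1.
Proof.
rewrite /hsym (bigD1 [ffun=> ord0]) /=; last first.
  by apply/andP; split; apply/forallP; case.
rewrite big_ord0 big1 ?addr0 // => f /andP[_ /eqP[]].
by apply/ffunP; case.
Qed.

Lemma hsymS a m :
  hsym a m.+1 = \sum_(b < N.+1 | (a <= b)%N) g b * hsym b m.
Proof.
rewrite /hsym (reindex _ (onW_bij _ (fcons_bij _ _))) /=.
under [RHS]eq_bigr do rewrite big_distrr.
rewrite pair_big_dep /=; apply: eq_big => [[b f]|[b f] _].
  by rewrite winc_fcons.
rewrite big_ord_recl fcons0; congr (_ * _).
by apply: eq_bigr => j _; rewrite fconsS.
Qed.

(** A weakly increasing tuple either starts with [a], and its tail is again bounded below by [a], or
    has all its entries above [a]. *)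
Lemma hsymS_rec a m : (a <= N)%N ->
  hsym a m.+1 = g a * hsym a m + hsym a.+1 m.+1.
Proof.
move=> leaN; rewrite !hsymS (bigD1 (inord a)) /= inordK //.
congr (_ + _); apply: eq_bigl => b; rewrite ltn_neqAle eq_sym andbC.
by congr (_ && _); rewrite -val_eqE /= inordK.
Qed.

Lemma hsymS_last m : hsym N.+1 m.+1 = 0.
Proof.
rewrite hsymS big1 // => b; case: b => /= b ltb; by rewrite leqNgt ltb.
Qed.

(** Telescoping by [hsymS_rec]: multiplication by [1 - g a] removes the variable [g a], up to an
    error in the top degree caused by truncation. *)
Lemma sum_hsym_rec a n : (a <= N)%N ->
  (1 - g a) * (\sum_(0 <= m < n.+1) hsym a m) =
  \sum_(0 <= m < n.+1) hsym a.+1 m - g a * hsym a n.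
Proof.
move=> leaN; rewrite mulrBl mul1r {1}big_nat_recl // [in RHS]big_nat_recl //.
rewrite big_nat_recr //= !hsym0.
under eq_bigr do rewrite hsymS_rec //.
rewrite big_split -big_distrr /= mulrDr.
set A := g a * \sum_(_ <= _ < _) _. rewrite opprD !addrA; congr (_ - _).
by rewrite addrAC addrK.
Qed.

End Homogeneous.

(** * Generating function for polynomials without constant term *)

Section HomPoly.

Variables (F : comNzRingType) (N : nat) (g : nat -> {poly F}).
Hypothesis g0 : forall r, (g r)`_0 = 0.

Lemma prod_coef0 (I : Type) (s : seq I) (p : I -> {poly F}) :
  (forall i, (p i)`_0 = 0) -> exists w, \prod_(i <- s) p i = 'X^(size s) * w.
Proof.
move=> p0; elim: s => [|i s [w IH]]; first by exists 1; rewrite big_nil mulr1.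
exists (drop_poly 1 (p i) * w); rewrite big_cons IH /= exprS.
suff {1}-> : p i = 'X * drop_poly 1 (p i) by rewrite mulrACA !mulrA.
apply/polyP => -[|j]; rewrite coefXM ?p0 //= coef_drop_poly addn1 //.
Qed.

Lemma hsym_order a n : exists w, hsym N g a n = 'X^n * w.
Proof.
rewrite /hsym; elim/big_rec: _ => [|r p _ [w ->]]; first by exists 0; rewrite mulr0.
have [v] := @prod_coef0 _ (index_enum 'I_n) (fun j => g (r j)) (fun _ => g0 _).
rewrite -sum1_size sum1_card card_ord => ->.
by exists (v + w); rewrite mulrDr.
Qed.

(** The factors [1 - g a] strip the variables one by one through [sum_hsym_rec]. Each error
    [g a * hsym a n] is divisible by X^(n+1), as every [g r] is divisible by X. *)
Lemma prod_hsym n : exists w,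
  (\prod_(1 <= r < N.+1) (1 - g r)) * (\sum_(0 <= m < n.+1) hsym N g 1 m) =
  1 + 'X^(n.+1) * w.
Proof.
have main d : (d <= N)%N -> exists w,
  (\prod_(N.+1 - d <= r < N.+1) (1 - g r)) *
  (\sum_(0 <= m < n.+1) hsym N g (N.+1 - d) m) = 1 + 'X^(n.+1) * w.
  elim: d => [_|d IH ltdN].
    exists 0; rewrite subn0 big_geq // mul1r mulr0 addr0 big_nat_recl //.
    by rewrite hsym0 big1 ?addr0 // => i _; rewrite hsymS_last.
  have [w ew] := IH (ltnW ltdN).
  rewrite subSS; set a := (N - d)%N.
  have ea : (N.+1 - d = a.+1)%N by rewrite subSn // ltnW.
  rewrite ea in ew.
  rewrite big_ltn ?ltnS ?leq_subr // mulrAC sum_hsym_rec ?leq_subr //.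
  rewrite mulrBl [X in X - _]mulrC ew.
  have [v ->] := hsym_order a n.
  have [u eu] := @prod_coef0 _ [:: tt] (fun=> g a) (fun _ => g0 _).
  rewrite big_seq1 /= expr1 in eu; rewrite eu.
  exists (w - u * v * \prod_(a.+1 <= r < N.+1) (1 - g r)).
  rewrite exprS mulrBr !mulrA addrA; congr (_ - _); congr (_ * _).
  by rewrite -!mulrA; congr (_ * _); rewrite !mulrA; congr (_ * _); exact: mulrC.
by have := main N (leqnn N); rewrite subSn // subnn.
Qed.

Lemma coef_prod_comp n m (p : 'I_m -> {poly F}) :
  (\prod_(j < m) p j)`_n =
  \sum_(i : {ffun 'I_m -> 'I_n.+1} | (\sum_(j < m) i j == n)%N)
    \prod_(j < m) (p j)`_(i j).
Proof.
(* Truncating each factor after degree [n] keeps the coefficient and makes all factors sums over one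
   finite type, so the product distributes. *)
have -> : (\prod_(j < m) p j)`_n = (\prod_(j < m) \sum_(i < n.+1) (p j)`_i *: 'X^i)`_n.
  pose E := fun a b : {poly F} => forall i, (i < n.+1)%N -> a`_i = b`_i.
  suff : E (\prod_(j < m) p j) (\prod_(j < m) \sum_(i < n.+1) (p j)`_i *: 'X^i).
    by move=> /(_ n); apply.
  apply: (big_ind2 E) => // [a b c d eab ecd i lti|j _ i lti].
    rewrite !coefM; apply: eq_bigr => -[k ltk] _ /=.
    rewrite eab ?ecd //; apply: leq_ltn_trans lti; first exact: leq_subr.
    by rewrite -ltnS.
  by rewrite -poly_def coef_poly lti.
rewrite bigA_distr_bigA coef_sum [RHS]big_mkcond /=; apply: eq_bigr => f _.
have -> : \prod_(j < m) ((p j)`_(f j) *: 'X^(f j)) =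
   (\prod_(j < m) (p j)`_(f j)) *: 'X^(\sum_(j < m) f j)%N.
  elim/big_rec3: _ => [|j a b c _ ->]; first by rewrite scale1r expr0.
  by rewrite -scalerAl -scalerAr scalerA -exprD.
by rewrite coefZ coefXn eq_sym; case: eqP; rewrite ?mulr1 ?mulr0.
Qed.

(** An exponent [i j = 0] selects a zero constant term, so only compositions survive. *)
Lemma coef_hsym n m :
  (hsym N g 1 m)`_n =
  \sum_(i : {ffun 'I_m -> 'I_n.+1} | composition i)
    \sum_(r : {ffun 'I_m -> 'I_N.+1} | weakly_increasing r)
      \prod_(j < m) (g (r j))`_(i j).
Proof.
rewrite /hsym coef_sum exchange_big; apply: eq_bigr => r _.
rewrite coef_prod_comp /composition [RHS]big_mkcondl; apply: eq_bigr => i _.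
case: ifP => // /negbT; rewrite negb_forall => /existsP[j].
by rewrite -leqNgt leqn0 => /eqP ij0; rewrite (bigD1 j) //= ij0 g0 mul0r.
Qed.

End HomPoly.

(** * Extracting a principal part at 0 from an identity of values *)

Lemma poly_vanish (F : numFieldType) (p : {poly F}) :
  (forall x, p.[x] = 0) -> p = 0.
Proof.
move=> p0; apply: (@roots_geq_poly_eq0 _ _ [seq i%:R | i <- iota 0 (size p)]).
- by apply/allP => x _; rewrite /root p0.
- rewrite map_inj_uniq ?iota_uniq // => i j /eqP.
  by rewrite eqr_nat => /eqP.
- by rewrite size_map size_iota.
Qed.

Section Regular.

Variable F : numFieldType.

(* [f] is a rational function without pole at 0, up to its (junk) values at the
   zeros of the chosen denominator. *)
Definition regular (f : F -> F) : Prop :=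
  exists B E : {poly F}, E.[0] != 0 /\
    forall x, E.[x] != 0 -> f x = B.[x] / E.[x].

Lemma regularD f g : regular f -> regular g -> regular (fun x => f x + g x).
Proof.
move=> [B [E [E0 fE]]] [B' [E' [E0' gE]]].
exists (B * E' + B' * E), (E * E'); split; first by rewrite hornerM mulf_neq0.
move=> x; rewrite !hornerE mulf_eq0 negb_or => /andP[Ex E'x].
by rewrite fE // gE // addf_div.
Qed.

Lemma regularM f g : regular f -> regular g -> regular (fun x => f x * g x).
Proof.
move=> [B [E [E0 fE]]] [B' [E' [E0' gE]]].
exists (B * B'), (E * E'); split; first by rewrite hornerM mulf_neq0.
move=> x; rewrite !hornerE mulf_eq0 negb_or => /andP[Ex E'x].
by rewrite fE // gE // mulf_div.
Qed.

Lemma regular_cst c : regular (fun=> c).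
Proof.
by exists c%:P, 1; split=> [|x _]; rewrite !hornerE ?oner_eq0 ?divr1 //.
Qed.

Lemma regular_sum (I : eqType) (s : seq I) (P : pred I) (f : I -> F -> F) :
  (forall i, i \in s -> P i -> regular (f i)) ->
  regular (fun x => \sum_(i <- s | P i) f i x).
Proof.
elim: s => [_|i s IH fs].
  have [B [E [E0 BE]]] := regular_cst 0.
  by exists B, E; split=> // x Ex; rewrite big_nil (BE x).
have [B [E [E0 BE]]] : regular (fun x =>
    (if P i then f i x else 0) + \sum_(j <- s | P j) f j x).
  apply: (@regularD (fun x => if P i then f i x else 0)).
    case: (boolP (P i)) => Pi; last exact: regular_cst.
    by apply: fs; rewrite ?mem_head.
  by apply: IH => j js; apply: fs; rewrite inE js orbT.
by exists B, E; split=> // x Ex; rewrite big_cons -(BE x) //; case: ifP; rewrite ?add0r.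
Qed.

Lemma regular_pole (a b c : F) l : a != 0 -> regular (fun x => c / (a + b * x) ^+ l).
Proof.
move=> a0; exists c%:P, ((a%:P + b *: 'X) ^+ l); split.
  by rewrite !hornerE expf_neq0.
by move=> x; rewrite !hornerE.
Qed.

Lemma mulX_coef0 (E D w : {poly F}) n i :
  E.[0] != 0 -> E * D = 'X^n * w -> (i < n)%N -> D`_i = 0.
Proof.
move=> E0 eED lti.
have : 'X^n %| D.
  rewrite -(@Gauss_dvdpr _ _ E) ?eED ?dvdp_mulr //.
  by rewrite coprimep_expl // coprimep_sym coprimepX.
by case/dvdpP => v ->; rewrite coefMXn lti.
Qed.

(** Multiplied by x^s, the expansion reads 1/U = sum_j a_j x^(s-j) + x^s f. Since [l >= 1], the term
    x^s f does not reach degree s - l, and up to that degree [V] agrees with the power series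
    1/U. *)
Lemma principal_part_coef (U V W : {poly F}) (s l : nat) (a : nat -> F)
    (f : F -> F) :
  U * V = 1 + 'X^((s - l).+1) * W -> (1 <= l <= s)%N -> regular f ->
  (forall x, x != 0 -> U.[x] != 0 ->
    (x ^+ s * U.[x])^-1 = \sum_(1 <= j < s.+1) a j / x ^+ j + f x) ->
  V`_(s - l) = a l.
Proof.
move=> UV /andP[l1 ls] [B [E [E0 fE]]] eqf.
set n := (s - l)%N in UV *.
have U0 : U != 0.
  apply/eqP => U0; have := congr1 (fun p : {poly F} => p`_0) UV.
  by rewrite U0 mul0r coef0 coefD coef1 coefXnM /= addr0 => /esym/eqP; rewrite oner_eq0.
have nzE : E != 0 by apply: contraNneq E0 => ->; rewrite horner0.
pose A : {poly F} := \sum_(1 <= j < s.+1) a j *: 'X^(s - j).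
have T0 : E - E * U * A - U * 'X^s * B = 0.
  (* The expansion is known only where x, [E] and [U] do not vanish. The extra factor kills the
     remaining points and, being a nonzero polynomial, cancels afterwards. *)
  apply/eqP; have : (E - E * U * A - U * 'X^s * B) * ('X * E * U) = 0.
    apply: poly_vanish => x; rewrite [LHS]hornerM.
    have [->|] := eqVneq ('X * E * U).[x] 0; first by rewrite mulr0.
    rewrite !hornerM hornerX !mulf_eq0 !negb_or => /andP[/andP[x0 Ex] Ux].
    have := eqf x x0 Ux; rewrite fE // => eqx.
    have Ax : A.[x] = x ^+ s * \sum_(1 <= j < s.+1) a j / x ^+ j.
      rewrite /A horner_sum mulr_sumr; apply: eq_big_nat => j /andP[_ js].
      rewrite hornerZ hornerXn mulrCA -[in RHS](subnK (n := s) (m := j)) ?exprD //.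
      by rewrite mulfK ?expf_neq0.
    have -> : (E - E * U * A - U * 'X^s * B).[x] = 0; last by rewrite mul0r.
    rewrite !(hornerE, hornerXn) Ax.
    move: (\sum_(_ <= _ < _) _) eqx => S eqx.
    have -> : S = (x ^+ s * U.[x])^-1 - B.[x] / E.[x] by rewrite eqx addrK.
    have xs0 : x ^+ s != 0 by rewrite expf_neq0.
    move: (x ^+ s) xs0 => y y0.
    by field; rewrite y0 Ux Ex.
  move/eqP; rewrite !mulf_eq0 polyX_eq0 (negbTE nzE) (negbTE U0) /=.
  by rewrite !orbF.
(* Multiply [T0] by [V], use that [U * V] is 1 modulo X^(n+1), and write s = (n+1) + (l-1). *)
have key : E * (V - A) = 'X^(n.+1) * (E * A * W + 'X^(l.-1) * (B * (U * V))).
  have es : 'X^s = 'X^(n.+1) * 'X^(l.-1) :> {poly F}.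
    by rewrite -exprD addSn -addnS prednK // subnK.
  transitivity (E * A * (U * V - 1) + 'X^s * B * (U * V)); last first.
    have -> : U * V - 1 = 'X^(n.+1) * W by rewrite UV addrC addKr.
    by rewrite es; ring.
  have -> : E * (V - A) = (E - E * U * A - U * 'X^s * B) * V
     + (E * A * (U * V - 1) + 'X^s * B * (U * V)) by ring.
  by rewrite T0 mul0r add0r.
have := mulX_coef0 E0 key (ltnSn n); rewrite coefB => /eqP.
rewrite subr_eq0 => /eqP ->.
rewrite /A coef_sum (bigD1_seq l) ?mem_index_iota ?l1 ?iota_uniq //=.
rewrite coefZ coefXn eqxx mulr1 big_seq_cond big1 ?addr0 // => j.
rewrite mem_index_iota => /andP[/andP[_ js] jl].
rewrite coefZ coefXn; case: eqP; rewrite ?mulr0 // => nj.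
by case/eqP: jl; rewrite -(subKn ls) -/n nj subKn.
Qed.

End Regular.

(** * The numbers e^{2 pi i h/k} as primitive roots of unity *)

Section Roots.

Variable R : realType.

Lemma unity_rootX h k : unity_root R h k = unity_root R 1 k ^+ h.
Proof.
elim: h => [|h IH]; first by rewrite /unity_root mulr0 mul0r cos0 sin0.
rewrite exprS -IH /unity_root.
have -> : 2 * pi * h.+1%:R / k%:R = 2 * pi * 1%:R / k%:R + 2 * pi * h%:R / k%:R :> R.
  by rewrite -mulrDl -mulrDr -natrD add1n.
by rewrite cosD sinD; simpc; rewrite [X in _ +i* X]addrC.
Qed.

(** If the order m were less than [k], then u = pi m/k would lie strictly between 0 and pi, so sin u
    > 0, while cos(2u) = 1 forces sin u = 0. *)
Lemma unity_root1_prim k : (0 < k)%N -> k.-primitive_root (unity_root R 1 k).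
Proof.
move=> k0.
have zk : unity_root R 1 k ^+ k = 1.
  rewrite -unity_rootX /unity_root mulfK ?pnatr_eq0 -?lt0n //.
  by rewrite mulrC mulr_natr cos2pi sin2pi.
have [m mprim mk] := prim_order_exists k0 zk.
suff mk' : m = k by move: mprim; rewrite {1}mk'.
apply/eqP; rewrite eqn_leq dvdn_leq //= leqNgt; apply/negP => ltmk.
have m0 := prim_order_gt0 mprim.
have /eqP := prim_expr_order mprim; rewrite -unity_rootX /unity_root.
set t : R := 2 * pi * m%:R / k%:R.
case/eqP => /eqP + _; pose u : R := pi * (m%:R / k%:R).
have -> : t = u *+ 2 by rewrite /t /u; ring.
rewrite cos_mulr2n cos2sin2.
have : 0 < sin u.
  apply: sin_gt0_pi; rewrite /u mulr_gt0 ?pi_gt0 ?divr_gt0 ?ltr0n //=.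
  by rewrite gtr_pMr ?pi_gt0 // ltr_pdivrMr ?ltr0n // mul1r ltr_nat.
by move=> u0 /eqP eu; clear -u0 eu; nra.
Qed.

Lemma unity_root_prim h k :
  (0 < k)%N -> coprime h k -> k.-primitive_root (unity_root R h k).
Proof.
by move=> k0 hk; rewrite unity_rootX (prim_root_exp_coprime _ (unity_root1_prim k0)).
Qed.

Lemma unity_root_inj h k h' k' : (h < k)%N -> (h' < k')%N ->
  coprime h k -> coprime h' k' ->
  unity_root R h k = unity_root R h' k' -> k = k' /\ h = h'.
Proof.
move=> hk hk' cop cop' e.
have k0 := leq_ltn_trans (leq0n _) hk; have k0' := leq_ltn_trans (leq0n _) hk'.
have p := unity_root_prim k0 cop; have p' := unity_root_prim k0' cop'.
have ek : k = k'.
  apply/eqP; rewrite eqn_dvd (prim_order_dvd p) e (prim_expr_order p') eqxx.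
  by rewrite (prim_order_dvd p') -e (prim_expr_order p) eqxx.
split=> //; move: e; rewrite -ek in hk' *; rewrite unity_rootX [RHS]unity_rootX.
move/eqP; rewrite (eq_prim_root_expr (unity_root1_prim k0)).
by rewrite !modn_small // => /eqP.
Qed.

End Roots.

(** * The constant and the power of x in front of the local expansion *)

Section Blocks.

Variables (F : numFieldType) (k : nat) (rho : F).
Hypothesis prho : k.-primitive_root rho.

(** Evaluate (X^k - 1)/(X - 1) = 1 + X + ... + X^(k-1) at 1. *)
Lemma prod_1_sub_prim : \prod_(1 <= d < k) (1 - rho ^+ d) = k%:R.
Proof.
have k0 := prim_order_gt0 prho.
have : \prod_(1 <= d < k) ('X - (rho ^+ d)%:P) = \sum_(i < k) 'X^i :> {poly F}.
  have nz : 'X - 1 != 0 :> {poly F} by rewrite -polyC1 polyXsubC_eq0.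
  by apply: (mulfI nz); rewrite -subrX1 -(factor_Xn_sub_1 prho) [RHS]big_ltn.
move/(congr1 (horner^~ 1)); rewrite horner_prod horner_sum.
under eq_bigr do rewrite !hornerE.
move=> ->; under eq_bigr do rewrite !hornerE expr1n.
by rewrite sumr_const card_ord.
Qed.

Definition leading_factor (x : F) (r : nat) : F :=
  if (k %| r)%N then - r%:R * x else 1 - rho ^+ r.

Lemma prod_leading_partial x s t : (t < k)%N ->
  \prod_((k * s).+1 <= r < (k * s + t).+1) leading_factor x r =
  \prod_(1 <= d < t.+1) (1 - rho ^+ d).
Proof.
move=> tk; rewrite -[(k * s).+1]add1n big_addn subSn ?leq_addr // addKn.
apply: eq_big_nat => d /andP[d1 dt]; rewrite /leading_factor addnC.
rewrite dvdn_addr ?dvdn_mulr // gtnNdvd ?(leq_ltn_trans _ tk) //.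
by rewrite exprD exprM (prim_expr_order prho) expr1n mul1r.
Qed.

(** The block of [k] indices ending at kj contributes k from the non-multiples of [k] and -kjx from
    kj itself. The [t] indices after the last full block give the remaining product. *)
Lemma prod_leading x s t : (t < k)%N ->
  \prod_(1 <= r < (k * s + t).+1) leading_factor x r =
  x ^+ s * ((-1) ^+ s * (k%:R ^+ (2 * s) * s`!%:R) *
    \prod_(1 <= d < t.+1) (1 - rho ^+ d)).
Proof.
move=> tk; rewrite (@big_cat_nat _ _ _ (k * s).+1) ?ltnS ?leq_addr //=.
rewrite prod_leading_partial // [RHS]mulrA; congr (_ * _).
have k0 := prim_order_gt0 prho.
elim: s => [|s IH]; first by rewrite muln0 big_geq // !expr0 !mul1r.
rewrite (@big_cat_nat _ _ _ (k * s).+1) ?ltnS ?leq_mul //= IH.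
have -> : (k * s.+1).+1 = (k * s + k.-1).+2 by rewrite -addnS prednK // mulnSr.
rewrite big_nat_recr ?ltnS ?leq_addr //= prod_leading_partial ?prednK //.
rewrite prod_1_sub_prim -addnS prednK // /leading_factor -mulnSr dvdn_mulr //.
rewrite ?factS !natrM mulnS exprD !exprS expr0; ring.
Qed.

End Blocks.

(** * Expansion of 1 - q^r at q = rho (1 + x) *)

Section LocalFactor.

Variables (R : realType) (k : nat) (rho : R[i]).
Hypothesis prho : k.-primitive_root rho.

(** This is g_r; stopping at degree [r] loses nothing, because the binomials in [G k rho r i] vanish
    for i > r. *)
Definition gpoly (r : nat) : {poly R[i]} :=
  \poly_(i < r.+1) (if i == 0 then 0 else G k rho r i).

Lemma gpoly_coef0 r : (gpoly r)`_0 = 0.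
Proof. by rewrite coef_poly. Qed.

Lemma coef_gpoly r i : (0 < i)%N -> (gpoly r)`_i = G k rho r i.
Proof.
case: i => // i _; rewrite coef_poly /=; case: ltnP => // ler.
by rewrite /G !bin_small ?mulr0 ?if_same // ltnW.
Qed.

(** Expand (1 + x)^r. If [k] divides [r], the constant term cancels and pulling out -rx shifts the
    binomial index by one, whence the i + 1 in [G]. *)
Lemma local_factor r x : (0 < r)%N ->
  1 - (rho * (1 + x)) ^+ r = leading_factor k rho x r * (1 - (gpoly r).[x]).
Proof.
case: r => // r _.
have gx : (gpoly r.+1).[x] = \sum_(i < r.+1) G k rho r.+1 i.+1 * x ^+ i.+1.
  by rewrite horner_poly big_ord_recl mul0r add0r.
have ex : (1 + x) ^+ r.+1 = 1 + \sum_(i < r.+1) 'C(r.+1, i.+1)%:R * x ^+ i.+1.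
  rewrite exprDn big_ord_recl expr1n expr0 mulr1 bin0 mulr1n; congr (_ + _).
  by apply: eq_bigr => i _; rewrite expr1n mul1r mulr_natl.
rewrite exprMn ex gx /leading_factor /G; case: ifPn => kr.
  have /eqP -> : rho ^+ r.+1 == 1 by rewrite -(prim_order_dvd prho).
  have r0 : r.+1%:R != 0 :> R[i] by rewrite pnatr_eq0.
  (* The left sum gives up its linear term and the right one its top term, which is zero; the
     lengths then match. *)
  rewrite mul1r big_ord_recl bin1 expr1 [in RHS]big_ord_recr /= bin_small //.
  rewrite mulr0 mul0r addr0 opprD addNKr mulrBr mulr1 opprD mulNr.
  congr (_ + _); rewrite mulr_sumr -!sumrN; apply: eq_bigr => i _.
  rewrite /bump /= add1n (exprS _ i.+1); move: (r.+1%:R : R[i]) r0 => y y0.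
  by field.
have nz : 1 - rho ^+ r.+1 != 0 by rewrite subr_eq0 eq_sym -(prim_order_dvd prho).
rewrite [RHS]mulrBr mulr1 mulrDr mulr1 opprD addrA; congr (_ - _).
by rewrite !mulr_sumr; apply: eq_bigr => i _; field.
Qed.

End LocalFactor.

(** * Comparison of the partial fractions with the expansion at rho *)

Theorem theorem8p3 (R : realType) (N : nat) (C : nat -> nat -> nat -> R[i])
    (h k l : nat) :
  (1 <= N)%N ->
  rademacher_coefficients N C ->
  (h < k)%N -> (k <= N)%N -> coprime h k ->
  let rho := unity_root R h k in
  let s := (N %/ k)%N in
  (1 <= l <= s)%N ->
  C h k l =
    (-1) ^+ s * rho ^+ l / (k%:R ^+ (2 * s) * s`!%:R)
    * (\prod_(1 <= d < (N - k * s).+1) (1 - rho ^+ d)^-1)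
    * \sum_(0 <= m < (s - l).+1)
        \sum_(i : {ffun 'I_m -> 'I_(s - l).+1} | composition i)
          \sum_(r : {ffun 'I_m -> 'I_N.+1} | weakly_increasing r)
            \prod_(j < m) G k rho (r j) (i j).
Proof.
move=> _ hC hk kN cop rho s ls.
have k0 : (0 < k)%N := leq_ltn_trans (leq0n _) hk.
have prho : k.-primitive_root rho := unity_root_prim R k0 cop.
have rho0 : rho != 0 by rewrite (prim_root_eq0 prho) -lt0n.
set t := (N - k * s)%N.
have tE : t = (N %% k)%N.
  by rewrite /t /s {1}(divn_eq N k) mulnC addKn.
have tk : (t < k)%N by rewrite tE ltn_mod.
have NE : N = (k * s + t)%N by rewrite tE /s mulnC -divn_eq.
pose Q := \prod_(1 <= d < t.+1) (1 - rho ^+ d).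
(* The constant supplied by [prod_leading]: the product of the 1 - q^j becomes c x^s U(x). *)
pose c : R[i] := (-1) ^+ s * (k%:R ^+ (2 * s) * s`!%:R) * Q.
have Q0 : Q != 0.
  rewrite /Q prodf_seq_neq0; apply/allP => d; rewrite mem_index_iota ltnS /=.
  move=> /andP[d0 dt].
  rewrite subr_eq0 eq_sym -(prim_order_dvd prho) gtnNdvd //.
  exact: leq_ltn_trans tk.
have c0 : c != 0.
  rewrite !mulf_neq0 // ?expf_neq0 ?oppr_eq0 ?oner_eq0 ?pnatr_eq0 -?lt0n //.
  exact: fact_gt0.
pose U := \prod_(1 <= r < N.+1) (1 - gpoly k rho r).
pose V := \sum_(0 <= m < (s - l).+1) hsym N (gpoly k rho) 1 m.
have [W UV] : exists W, U * V = 1 + 'X^((s - l).+1) * W :=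
  prod_hsym N (gpoly_coef0 k rho) (s - l).
have den x : \prod_(1 <= j < N.+1) (1 - (rho * (1 + x)) ^+ j) =
    x ^+ s * c * U.[x].
  transitivity (\prod_(1 <= j < N.+1)
      (leading_factor k rho x j * (1 - (gpoly k rho j).[x]))).
    by apply: eq_big_nat => j /andP[j0 _]; exact: local_factor.
  rewrite big_split /= {1}NE (prod_leading prho) // -/Q -/c; congr (_ * _).
  by rewrite ?/U horner_prod; apply: eq_bigr => j _; rewrite !hornerE.
pose pole x k' h' : R[i] := \sum_(1 <= j < (N %/ k').+1)
   C h' k' j / (rho * (1 + x) - unity_root R h' k') ^+ j.
(* All poles other than rho: those of the same order [k], then those of other orders. *)
pose rest x := \sum_(0 <= h' < k | coprime h' k && (h' != h)) pole x k h' +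
  \sum_(1 <= k' < N.+1 | k' != k)
    \sum_(0 <= h' < k' | coprime h' k') pole x k' h'.
have reg_rest : regular rest.
  have reg_pole k' h' : (h' < k')%N -> coprime h' k' -> (k' != k) || (h' != h) ->
      regular (fun x => pole x k' h').
    move=> hk' cop' ne; apply: regular_sum => j _ _.
    (* In x the denominator is a power of (rho - rho') + rho x, where rho' is the other root; this
       constant term must not vanish. *)
    have ne0 : rho - unity_root R h' k' != 0.
      rewrite subr_eq0; apply: contraTneq ne => e.
      by have [-> ->] := unity_root_inj hk hk' cop cop' e; rewrite !eqxx.
    have [B [E [E0 BE]]] := regular_pole rho (C h' k' j) j ne0.
    exists B, E; split=> // x Ex; rewrite -BE //; congr (_ / _ ^+ _); ring.
  apply: regularD.
    apply: regular_sum => h'; rewrite mem_index_iota => /andP[_ hk'].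
    by move=> /andP[cop' ne]; apply: reg_pole; rewrite // ne orbT.
  apply: regular_sum => k' _ ne; apply: regular_sum => h'.
  by rewrite mem_index_iota => /andP[_ hk'] cop'; apply: reg_pole; rewrite // ne.
have main : V`_(s - l) = c * (C h k l / rho ^+ l).
  (* The factor [c] turns 1/(x^s c U) into 1/(x^s U), and rho^j comes from q - rho = rho x. *)
  pose a j := c * (C h k j / rho ^+ j).
  apply: (principal_part_coef (a := a) UV ls (regularM (regular_cst c) reg_rest)).
  move=> x x0 Ux.
  have nz : \prod_(1 <= j < N.+1) (1 - (rho * (1 + x)) ^+ j) != 0.
    by rewrite den mulf_neq0 // mulf_neq0 // expf_neq0.
  have nonpole j : (1 <= j <= N)%N -> (rho * (1 + x)) ^+ j != 1.
    move=> j1N; apply: contraNneq nz => qj.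
    by rewrite (bigD1_seq j) ?mem_index_iota ?iota_uniq //= qj subrr mul0r.
  have := hC _ nonpole; rewrite prodfV den => eqC.
  have -> : (x ^+ s * U.[x])^-1 = c * (x ^+ s * c * U.[x])^-1.
    by rewrite (mulrAC _ c) (mulrC _ c) [in RHS]invfM mulVKf.
  rewrite eqC (bigD1_seq k) ?mem_index_iota ?iota_uniq ?k0 //=.
  rewrite -big_filter (bigD1_seq h) ?mem_filter ?filter_uniq ?iota_uniq //=; last first.
    by rewrite cop mem_index_iota.
  rewrite big_filter_cond -addrA mulrDr; congr (_ + _).
  rewrite /pole /a mulr_sumr; apply: eq_bigr => j _; rewrite -[RHS](mulrA c); congr (_ * _).
  have -> : rho * (1 + x) - unity_root R h k = rho * x by rewrite -/rho; ring.
  by rewrite exprMn invfM mulrA.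
have Vcoef : V`_(s - l) = \sum_(0 <= m < (s - l).+1)
        \sum_(i : {ffun 'I_m -> 'I_(s - l).+1} | composition i)
          \sum_(r : {ffun 'I_m -> 'I_N.+1} | weakly_increasing r)
            \prod_(j < m) G k rho (r j) (i j).
  rewrite coef_sum; apply: eq_bigr => m _; rewrite coef_hsym; last exact: gpoly_coef0.
  apply: eq_bigr => i /andP[/forallP i0 _]; apply: eq_bigr => r _.
  by apply: eq_bigr => j _; rewrite coef_gpoly.
have rl0 : rho ^+ l != 0 by rewrite expf_neq0.
rewrite -Vcoef main prodfV -/Q.
have -> : (-1) ^+ s * rho ^+ l / (k%:R ^+ (2 * s) * s`!%:R) =
   rho ^+ l / ((-1) ^+ s * (k%:R ^+ (2 * s) * s`!%:R)).
  by rewrite invr_signM mulrCA mulrA.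
rewrite -[rho ^+ l / _ / Q]mulrA -invfM -/c.
by rewrite -[RHS]mulrA mulKf // mulrC divfK.
Qed.
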